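(* Let $(\Omega,\nu)$ be a measure space. Then $\mathcal{L}_{\log}(\Omega,\nu)$, with pointwise operations and the topology induced by the metric $d_{\log}(f,g)=\|f-g\|_{\log}=\int\log(1+|f-g|)\,d\nu$, is a topological algebra, and the metric $d_{\log}$ is complete.
   Context: $\mathcal{L}_{\log}(\Omega,\nu)$ is the set of measurable complex-valued functions $f$ on $\Omega$ (functions agreeing almost everywhere are identified) such that $\|f\|_{\log}:=\int\log(1+|f|)\,d\nu<\infty$. A topological algebra is an algebra over $\mathbb{C}$ or $\mathbb{R}$ with a topology for which addition, scalar multiplication and multiplication are jointly continuous. *)

(* Defs.v *)
From HB Require Import structures.
From mathcomp Require Import all_boot all_order all_algebra generic_quotient.
From mathcomp Require Import complex.
From mathcomp Require Import all_classical all_reals all_analysis measurable_realfun.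
From mathcomp Require Import ring lra.

Set Implicit Arguments.
Unset Strict Implicit.
Unset Printing Implicit Defensive.

Import Order.TTheory GRing.Theory Num.Theory ComplexField.Normc.
Import numFieldNormedType.Exports.

Local Open Scope classical_set_scope.
Local Open Scope ring_scope.
Local Open Scope quotient_scope.

(* Algebras are associative and bilinear but not assumed unital: the constant
   function 1 is not in L_log when the measure is infinite, so the library's
   [algType] does not apply. *)
Definition is_algebra_mul (K : pzRingType) (A : lmodType K)
    (mul : A -> A -> A) : Prop :=
  [/\ associative mul, left_distributive mul +%R, right_distributive mul +%R,
      (forall (c : K) (a b : A), mul (c *: a) b = c *: mul a b)
    & (forall (c : K) (a b : A), mul a (c *: b) = c *: mul a b)].

Definition is_topological_algebra (K : numFieldType)
    (A : preTopologicalLmodType K) (mul : A -> A -> A) : Prop :=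
  [/\ is_algebra_mul mul,
      continuous (fun z : A * A => z.1 + z.2),
      continuous (fun z : K^o * A => z.1 *: z.2)
    & continuous (fun z : A * A => mul z.1 z.2)].

Definition is_complete_metric (R : realType) (M : metricType R) : Prop :=
  forall u : nat -> M,
    (forall e : R, 0 < e -> exists N : nat, forall m n : nat,
        (N <= m)%N -> (N <= n)%N -> mdist (u m) (u n) < e) ->
    exists l : M, u n @[n --> \oo] --> l.

Section LogBound.
Context {R : realType}.
Implicit Types z w : R[i].

Lemma normc_ge0 z : 0 <= normc z.
Proof. by case: z => a b; exact: sqrtr_ge0. Qed.

Lemma ler_normcD z w : normc (z + w) <= normc z + normc w.
Proof. exact: (@le_normcD R z w). Qed.

Definition log1p (z : R[i]) : R := ln (1 + normc z).

Lemma log1p_ge0 z : 0 <= log1p z.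
Proof. by apply: ln_ge0; rewrite lerDl normc_ge0. Qed.

Lemma log1p0 : log1p 0 = 0.
Proof. by rewrite /log1p normc0 addr0 ln1. Qed.

Lemma log1p_eq0 z : log1p z = 0 -> z = 0.
Proof.
move=> /eqP; rewrite ln_eq0; last by rewrite ltr_wpDr ?normc_ge0.
by rewrite -subr_eq0 addrC addKr => /eqP/eq0_normc.
Qed.

Lemma log1pN z : log1p (- z) = log1p z.
Proof. by rewrite /log1p (@normcN R z). Qed.

Lemma log1p_le z w : normc z <= normc w -> log1p z <= log1p w.
Proof.
move=> zw; rewrite ler_ln ?posrE ?lerD2l//.
  by rewrite ltr_wpDr ?normc_ge0.
by rewrite ltr_wpDr ?normc_ge0.
Qed.

Lemma ln1p_mul_le (a b c : R) : 0 <= a -> 0 <= b -> 0 <= c ->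
  c <= a + b + a * b -> ln (1 + c) <= ln (1 + a) + ln (1 + b).
Proof.
move=> a0 b0 c0 cab.
have a1 : 0 < 1 + a by lra.
have b1 : 0 < 1 + b by lra.
have c1 : 0 < 1 + c by lra.
rewrite -lnM ?posrE// ler_ln ?posrE ?mulr_gt0//; nra.
Qed.

Lemma log1pD z w : log1p (z + w) <= log1p z + log1p w.
Proof.
have zw := ler_normcD z w.
have p0 := mulr_ge0 (normc_ge0 z) (normc_ge0 w).
by apply: ln1p_mul_le; rewrite ?normc_ge0 //; move: zw p0; lra.
Qed.

Lemma log1pM z w : log1p (z * w) <= log1p z + log1p w.
Proof.
apply: ln1p_mul_le; rewrite ?normc_ge0 //.
have := normc_ge0 z; have := normc_ge0 w; rewrite normcM; lra.
Qed.

Lemma log1pMn z n : log1p (z *+ n) <= n%:R * log1p z.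
Proof.
elim: n => [|n IH]; first by rewrite mulr0n log1p0 mul0r.
rewrite mulrS (le_trans (log1pD _ _))// -natr1 mulrDl mul1r addrC.
by rewrite lerD2r.
Qed.

Lemma log1pZ (c z : R[i]) :
  log1p (c * z) <= (Num.truncn (normc c)).+1%:R * log1p z.
Proof.
apply: le_trans (log1pMn z _); apply: log1p_le.
rewrite normcM (@normcMn R z) -[leRHS]mulr_natl ler_wpM2r ?normc_ge0//.
by apply/ltW; exact: truncnS_gt.
Qed.

End LogBound.

Section Llog.
Context {d : measure_display} {T : measurableType d} {R : realType}.
Context (mu : {measure set T -> \bar R}).
Implicit Types f g h : T -> R[i].

(* Borel measurability into C, read through the identification C = R^2. *)
Definition cmeasurable f : Prop :=
  measurable_fun [set: T] (fun x => complex.Re (f x)) /\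
  measurable_fun [set: T] (fun x => complex.Im (f x)).

(* [normc] is the modulus with values in R; [`|z|] would live in R[i]. *)
Definition lognorm f : \bar R := (\int[mu]_x (ln (1 + normc (f x)))%:E)%E.

Lemma cmeasurable_cst c : cmeasurable (fun=> c).
Proof. by split; exact: measurable_cst. Qed.

Lemma cmeasurableD f g : cmeasurable f -> cmeasurable g ->
  cmeasurable (fun x => f x + g x).
Proof.
move=> [f1 f2] [g1 g2]; split.
  rewrite (_ : (fun _ => _) =
    (fun x => complex.Re (f x)) \+ (fun x => complex.Re (g x))).
    exact: measurable_funD.
  by apply/funext => x /=; case: (f x) (g x) => [? ?] [? ?].
rewrite (_ : (fun _ => _) =
  (fun x => complex.Im (f x)) \+ (fun x => complex.Im (g x))).
  exact: measurable_funD.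
by apply/funext => x /=; case: (f x) (g x) => [? ?] [? ?].
Qed.

Lemma cmeasurableM f g : cmeasurable f -> cmeasurable g ->
  cmeasurable (fun x => f x * g x).
Proof.
move=> [f1 f2] [g1 g2]; split.
  rewrite (_ : (fun _ => _) =
    ((fun x => complex.Re (f x)) \* (fun x => complex.Re (g x))) \-
    ((fun x => complex.Im (f x)) \* (fun x => complex.Im (g x)))).
    by apply: measurable_funB; exact: measurable_funM.
  by apply/funext => x /=; case: (f x) (g x) => [? ?] [? ?].
rewrite (_ : (fun _ => _) =
  ((fun x => complex.Re (f x)) \* (fun x => complex.Im (g x))) \+
  ((fun x => complex.Im (f x)) \* (fun x => complex.Re (g x)))).
  by apply: measurable_funD; exact: measurable_funM.
by apply/funext => x /=; case: (f x) (g x) => [? ?] [? ?].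
Qed.

Lemma measurable_log1p f : cmeasurable f ->
  measurable_fun [set: T] (fun x => (log1p (f x))%:E).
Proof.
move=> [f1 f2]; apply/measurable_EFinP.
apply: (@measurableT_comp _ _ _ _ _ _ (@ln R)); first exact: measurable_ln.
apply: measurable_funD; first exact: measurable_cst.
rewrite (_ : (fun _ => _) = (@Num.sqrt R) \o
   ((fun x => complex.Re (f x) ^+ 2) \+ (fun x => complex.Im (f x) ^+ 2))).
  apply: measurableT_comp.
    by apply: continuous_measurable_fun; exact: sqrt_continuous.
  by apply: measurable_funD; exact: measurable_funX.
by apply/funext => x /=; case: (f x).
Qed.

Lemma lognorm_ge0 f : (0 <= lognorm f)%E.
Proof. by apply: integral_ge0 => x _; rewrite lee_fin log1p_ge0. Qed.

Lemma le_lognorm2 f g h : cmeasurable f -> cmeasurable g -> cmeasurable h ->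
  (forall x, log1p (h x) <= log1p (f x) + log1p (g x)) ->
  (lognorm h <= lognorm f + lognorm g)%E.
Proof.
move=> mf mg mh hfg; rewrite /lognorm -ge0_integralD//=.
- apply: ge0_le_integral => //=.
  + by move=> x _; rewrite lee_fin log1p_ge0.
  + exact: measurable_log1p.
  + by apply: emeasurable_funD; exact: measurable_log1p.
  + by move=> x _; rewrite -EFinD lee_fin hfg.
- by move=> x _; rewrite lee_fin log1p_ge0.
- exact: measurable_log1p.
- by move=> x _; rewrite lee_fin log1p_ge0.
- exact: measurable_log1p.
Qed.

Definition in_Llog f : Prop := cmeasurable f /\ (lognorm f < +oo)%E.

Lemma in_Llog0 : in_Llog (fun=> 0).
Proof.
split; first exact: cmeasurable_cst.
by rewrite /lognorm normc0 addr0 ln1 integral0.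
Qed.

Lemma in_LlogD f g : in_Llog f -> in_Llog g -> in_Llog (fun x => f x + g x).
Proof.
move=> [mf lf] [mg lg]; have mD := cmeasurableD mf mg; split=> //.
apply: (@le_lt_trans _ _ (lognorm f + lognorm g)%E); last exact: lte_add_pinfty.
by apply: le_lognorm2 => // x; exact: log1pD.
Qed.

Lemma in_LlogM f g : in_Llog f -> in_Llog g -> in_Llog (fun x => f x * g x).
Proof.
move=> [mf lf] [mg lg]; have mM := cmeasurableM mf mg; split=> //.
apply: (@le_lt_trans _ _ (lognorm f + lognorm g)%E); last exact: lte_add_pinfty.
by apply: le_lognorm2 => // x; exact: log1pM.
Qed.

Lemma in_LlogZ (c : R[i]) f : in_Llog f -> in_Llog (fun x => c * f x).
Proof.
move=> [mf lf]; have mZ := cmeasurableM (cmeasurable_cst c) mf; split=> //.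
apply: (@le_lt_trans _ _
  (\int[mu]_x ((Num.truncn (normc c)).+1%:R%:E * (log1p (f x))%:E))%E).
  apply: ge0_le_integral => //=.
  - by move=> x _; rewrite lee_fin log1p_ge0.
  - exact: measurable_log1p.
  - by apply: measurable_funeM; exact: measurable_log1p.
  - by move=> x _; rewrite -EFinM lee_fin log1pZ.
rewrite ge0_integralZl//.
- by apply: lte_mul_pinfty.
- exact: measurable_log1p.
- by move=> x _; rewrite lee_fin log1p_ge0.
Qed.

Lemma in_LlogN f : in_Llog f -> in_Llog (fun x => - f x).
Proof.
move=> /(in_LlogZ (-1)); rewrite (_ : (fun _ => _) = (fun x => - f x))//.
by apply/funext => x; rewrite mulN1r.
Qed.

(* Boolean proof field, so that [Llogfun] is a subType of [T -> R[i]]. *)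
Record Llogfun := MkLlogfun {
  Llogfun_val :> T -> R[i] ;
  Llogfun_subproof : `[< in_Llog Llogfun_val >]
}.

HB.instance Definition _ := [isSub for Llogfun_val].
HB.instance Definition _ := [Choice of Llogfun by <:].

Lemma LlogfunP (f : Llogfun) : in_Llog f.
Proof. by apply/asboolP; exact: Llogfun_subproof. Qed.

Definition mkLlogfun f (h : in_Llog f) : Llogfun := MkLlogfun (asboolT h).

Definition Llog_rel (f g : Llogfun) : bool :=
  `[< (f : T -> R[i]) = g %[ae mu] >].

Lemma Llog_rel_refl : reflexive Llog_rel.
Proof. by move=> f; apply/asboolP; exact: ae_eq_refl. Qed.

Lemma Llog_rel_sym : symmetric Llog_rel.
Proof.
by move=> f g; apply/idP/idP => /asboolP h; apply/asboolP/ae_eq_sym.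
Qed.

Lemma Llog_rel_trans : transitive Llog_rel.
Proof.
by move=> f g h /asboolP gf /asboolP fh; apply/asboolP/(ae_eq_trans gf fh).
Qed.

Canonical Llog_equiv :=
  EquivRel Llog_rel Llog_rel_refl Llog_rel_sym Llog_rel_trans.

(* The space L_log: functions modulo almost-everywhere equality. *)
Definition Llog : Type := {eq_quot Llog_rel}.
HB.instance Definition _ := Choice.on Llog.
HB.instance Definition _ := EqQuotient.on Llog.

Definition Llog_class (f : Llogfun) : Llog := \pi_Llog f.

Lemma Llog_classP (f g : Llogfun) :
  Llog_class f = Llog_class g <-> (f : T -> R[i]) = g %[ae mu].
Proof.
split=> [/eqP|fg]; first by rewrite eqmodE => /asboolP.
by apply/eqP; rewrite eqmodE; apply/asboolP.
Qed.

Lemma reprLlogK (F : Llog) : Llog_class (repr F) = F.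
Proof. exact: reprK. Qed.

Lemma repr_Llog_class (f : Llogfun) :
  (repr (Llog_class f) : T -> R[i]) = f %[ae mu].
Proof. by apply/Llog_classP; rewrite reprLlogK. Qed.

Lemma Llog_ind (P : Llog -> Prop) :
  (forall f : Llogfun, P (Llog_class f)) -> forall F, P F.
Proof. by move=> h F; rewrite -(reprLlogK F); exact: h. Qed.

Definition Llogfun0 : Llogfun := mkLlogfun in_Llog0.
Definition LlogfunD (f g : Llogfun) : Llogfun :=
  mkLlogfun (in_LlogD (LlogfunP f) (LlogfunP g)).
Definition LlogfunN (f : Llogfun) : Llogfun :=
  mkLlogfun (in_LlogN (LlogfunP f)).
Definition LlogfunZ (c : R[i]) (f : Llogfun) : Llogfun :=
  mkLlogfun (in_LlogZ c (LlogfunP f)).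
Definition LlogfunM (f g : Llogfun) : Llogfun :=
  mkLlogfun (in_LlogM (LlogfunP f) (LlogfunP g)).

Definition Llog_add (F G : Llog) : Llog :=
  Llog_class (LlogfunD (repr F) (repr G)).
Definition Llog_opp (F : Llog) : Llog := Llog_class (LlogfunN (repr F)).
Definition Llog_scale (c : R[i]) (F : Llog) : Llog :=
  Llog_class (LlogfunZ c (repr F)).
Definition Llog_mul (F G : Llog) : Llog :=
  Llog_class (LlogfunM (repr F) (repr G)).

Lemma Llog_addE (f g : Llogfun) :
  Llog_add (Llog_class f) (Llog_class g) = Llog_class (LlogfunD f g).
Proof.
apply/Llog_classP; move: (repr_Llog_class f) (repr_Llog_class g).
by apply: filterS2 => x /= /(_ I) -> /(_ I) ->.
Qed.

Lemma Llog_mulE (f g : Llogfun) :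
  Llog_mul (Llog_class f) (Llog_class g) = Llog_class (LlogfunM f g).
Proof.
apply/Llog_classP; move: (repr_Llog_class f) (repr_Llog_class g).
by apply: filterS2 => x /= /(_ I) -> /(_ I) ->.
Qed.

Lemma Llog_oppE (f : Llogfun) : Llog_opp (Llog_class f) = Llog_class (LlogfunN f).
Proof.
apply/Llog_classP; move: (repr_Llog_class f).
by apply: filterS => x /= /(_ I) ->.
Qed.

Lemma Llog_scaleE c (f : Llogfun) :
  Llog_scale c (Llog_class f) = Llog_class (LlogfunZ c f).
Proof.
apply/Llog_classP; move: (repr_Llog_class f).
by apply: filterS => x /= /(_ I) ->.
Qed.

Lemma Llogfun_eq (f g : Llogfun) : f =1 g -> Llog_class f = Llog_class g.
Proof. by move=> fg; congr Llog_class; apply/val_inj/funext. Qed.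

Lemma Llog_addA : associative Llog_add.
Proof.
elim/Llog_ind=> f; elim/Llog_ind=> g; elim/Llog_ind=> h.
by rewrite !Llog_addE; apply: Llogfun_eq => x /=; rewrite addrA.
Qed.

Lemma Llog_addC : commutative Llog_add.
Proof.
elim/Llog_ind=> f; elim/Llog_ind=> g.
by rewrite !Llog_addE; apply: Llogfun_eq => x /=; rewrite addrC.
Qed.

Lemma Llog_add0 : left_id (Llog_class Llogfun0) Llog_add.
Proof.
elim/Llog_ind=> f.
by rewrite !Llog_addE; apply: Llogfun_eq => x /=; rewrite add0r.
Qed.

Lemma Llog_addN : left_inverse (Llog_class Llogfun0) Llog_opp Llog_add.
Proof.
elim/Llog_ind=> f.
by rewrite Llog_oppE Llog_addE; apply: Llogfun_eq => x /=; rewrite addNr.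
Qed.

HB.instance Definition _ :=
  GRing.isZmodule.Build Llog Llog_addA Llog_addC Llog_add0 Llog_addN.

Lemma Llog_scaleA a b F : Llog_scale a (Llog_scale b F) = Llog_scale (a * b) F.
Proof.
elim/Llog_ind: F => f.
by rewrite !Llog_scaleE; apply: Llogfun_eq => x /=; rewrite mulrA.
Qed.

Lemma Llog_scale1 : left_id 1 Llog_scale.
Proof.
elim/Llog_ind=> f.
by rewrite !Llog_scaleE; apply: Llogfun_eq => x /=; rewrite mul1r.
Qed.

Lemma Llog_scaleDr : right_distributive Llog_scale +%R.
Proof.
move=> c; elim/Llog_ind=> f; elim/Llog_ind=> g.
rewrite -[(_ + _)%R]/(Llog_add _ _) -[RHS]/(Llog_add _ _).
rewrite Llog_addE !Llog_scaleE Llog_addE.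
by apply: Llogfun_eq => x /=; rewrite mulrDr.
Qed.

Lemma Llog_scaleDl F : {morph Llog_scale^~ F : a b / a + b}.
Proof.
move=> a b; elim/Llog_ind: F => f.
rewrite -[RHS]/(Llog_add _ _) !Llog_scaleE Llog_addE.
by apply: Llogfun_eq => x /=; rewrite mulrDl.
Qed.

HB.instance Definition _ := GRing.Zmodule_isLmodule.Build R[i] Llog
  Llog_scaleA Llog_scale1 Llog_scaleDr Llog_scaleDl.

Lemma Llog_subE (f g : Llogfun) :
  Llog_class f - Llog_class g = Llog_class (LlogfunD f (LlogfunN g)).
Proof. by rewrite -[LHS]/(Llog_add _ (Llog_opp _)) Llog_oppE Llog_addE. Qed.

Definition Llog_norm (F : Llog) : R := fine (lognorm (repr F)).

Definition Llog_dist (F G : Llog) : R := Llog_norm (F - G).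

Lemma lognorm_fin (f : Llogfun) : lognorm f \is a fin_num.
Proof.
by rewrite ge0_fin_numE ?lognorm_ge0//; have [] := LlogfunP f.
Qed.

Lemma Llog_normE (f : Llogfun) : Llog_norm (Llog_class f) = fine (lognorm f).
Proof.
congr fine; apply: ae_eq_integral => //.
- by apply: measurable_log1p; have [] := LlogfunP (repr (Llog_class f)).
- by apply: measurable_log1p; have [] := LlogfunP f.
- by move: (repr_Llog_class f); apply: filterS => x /[apply] ->.
Qed.

Lemma Llog_distE (f g : Llogfun) :
  (Llog_dist (Llog_class f) (Llog_class g))%:E =
  (\int[mu]_x (ln (1 + normc (f x - g x)))%:E)%E.
Proof. by rewrite /Llog_dist Llog_subE Llog_normE fineK ?lognorm_fin. Qed.

Lemma Llog_distxx F : Llog_dist F F = 0.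
Proof.
elim/Llog_ind: F => f; apply: EFin_inj; rewrite Llog_distE.
under eq_integral do rewrite subrr normc0 addr0 ln1.
by rewrite integral0.
Qed.

Lemma Llog_dist_sym F G : Llog_dist F G = Llog_dist G F.
Proof.
elim/Llog_ind: F => f; elim/Llog_ind: G => g.
apply: EFin_inj; rewrite !Llog_distE; apply: eq_integral => x _.
by rewrite -[f x - g x]opprB -[in RHS]/(log1p _) -log1pN.
Qed.

Lemma Llog_dist_eq0 F G : Llog_dist F G = 0 -> F = G.
Proof.
elim/Llog_ind: F => f; elim/Llog_ind: G => g fg; apply/Llog_classP.
have mfg : cmeasurable (fun x => f x - g x).
  by have [] := LlogfunP (LlogfunD f (LlogfunN g)).
have /(ae_eq_integral_abs mu measurableT (measurable_log1p mfg)) :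
    (\int[mu]_x `|(log1p (f x - g x))%:E|)%E = 0%E.
  rewrite -[RHS]/(EFin 0) -fg Llog_distE; apply: eq_integral => x _.
  by rewrite gee0_abs// lee_fin log1p_ge0.
apply: filterS => x /(_ I) /= [/log1p_eq0 h] _.
by apply/eqP; rewrite -subr_eq0 h.
Qed.

Lemma Llog_dist_triangle G F H :
  Llog_dist F H <= Llog_dist F G + Llog_dist G H.
Proof.
elim/Llog_ind: F => f; elim/Llog_ind: G => g; elim/Llog_ind: H => h.
rewrite -lee_fin EFinD !Llog_distE.
have m (a b : Llogfun) : cmeasurable (fun x => a x - b x).
  by have [] := LlogfunP (LlogfunD a (LlogfunN b)).
apply: le_lognorm2 => // x.
by rewrite (_ : f x - h x = (f x - g x) + (g x - h x)) ?log1pD// addrA subrK.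
Qed.

(* The topology and uniformity of [Llog mu] are the ones of this metric. *)
HB.instance Definition _ := isMetric.Build R Llog
  Llog_distxx Llog_dist_eq0 Llog_dist_sym Llog_dist_triangle.

Lemma mdist_LlogE (F G : Llog) : mdist F G = Llog_dist F G.
Proof. by []. Qed.

End Llog.

(* Main.v *)
(** The quantity [ln (1 + |z|)] is subadditive for both the sum and the product
    of complex numbers, so only the continuity of [G |-> F G] at [0] and of
    [c |-> c F] at [0] need an argument.  Cutting [f] at height [n] gives
    [ln (1 + |f g|) <= (n + 1) ln (1 + |g|) + ln (1 + |f| 1_{|f| > n})] and,
    for [|c| <= 1], since [t <= (1 + t) ln (1 + t)],
    [ln (1 + |c f|) <= |c| (n + 1) ln (1 + |f|) + ln (1 + |f| 1_{|f| > n})];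
    the last terms have small integral for [n] large by dominated convergence.

    For completeness, pass to a subsequence [v] with summable successive
    distances.  Almost everywhere [S = sum_j ln (1 + |v_{j+1} - v_j|)] is
    finite, and then [|v_{j+1} - v_j| <= e^S ln (1 + |v_{j+1} - v_j|)] shows that [v]
    converges pointwise; subadditivity bounds the distance from [v_k] to the
    limit by the [k]-th tail of the series. *)

Require Import Defs.
From mathcomp Require Import all_boot all_order all_algebra complex.
From mathcomp Require Import all_classical all_reals all_analysis measurable_realfun.
From mathcomp Require Import ring lra.

Set Implicit Arguments.
Unset Strict Implicit.
Unset Printing Implicit Defensive.

Import Order.TTheory GRing.Theory Num.Theory ComplexField.Normc.
Import numFieldNormedType.Exports.

Local Open Scope classical_set_scope.
Local Open Scope ring_scope.

(** * Pointwise bounds on [log1p] and truncation at height [n] *)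

Section Log1p.
Context {R : realType}.
Implicit Types (z w c : R[i]) (n : nat).

Lemma log1p_le_normc z : log1p z <= normc z.
Proof. by apply: le_ln1Dx; have := normc_ge0 z; lra. Qed.

(** This is [ln (1 + x) <= x] taken at [x = 1 / (1 + |z|) - 1], then multiplied by [1 + |z|]. *)
Lemma normc_le_log1p z : normc z <= (1 + normc z) * log1p z.
Proof.
have z0 := normc_ge0 z; have z1 : 0 < 1 + normc z by lra.
have v0 : 0 < (1 + normc z)^-1 by rewrite invr_gt0.
have v1 : (1 + normc z) * (1 + normc z)^-1 = 1 by rewrite divff// gt_eqF.
have := @le_ln1Dx R ((1 + normc z)^-1 - 1).
rewrite [1 + (_ - 1)]addrC subrK lnV ?posrE//.
rewrite -/(log1p z) => h; have {}h := h ltac:(lra).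
have : (1 + normc z) * (1 - (1 + normc z)^-1) <= (1 + normc z) * log1p z.
  by apply: ler_wpM2l; lra.
by rewrite mulrBr v1 mulr1; lra.
Qed.

Definition ctail n z : R[i] := if n%:R < normc z then z else 0.

(** Where [|z| <= n], the product is no larger in modulus than the [n.+1]-fold sum of [w], and
    [log1p] is subadditive; elsewhere the tail is [z] itself and the bound for products suffices. *)
Lemma log1pM_ctail n z w :
  log1p (z * w) <= n.+1%:R * log1p w + log1p (ctail n z).
Proof.
have w0 := log1p_ge0 w; rewrite /ctail; case: ltP => zn.
  rewrite (le_trans (log1pM z w))// addrC lerD2r -natr1 mulrDl mul1r.
  by rewrite lerDr mulr_ge0.
rewrite log1p0 addr0; apply: le_trans (log1pMn w n.+1); apply: log1p_le.
rewrite normcM (@normcMn R w) -[leRHS]mulr_natl ler_wpM2r ?normc_ge0//.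
by rewrite (le_trans zn)// ler_nat.
Qed.

(** Unlike [log1pZ], this bound has a main term that vanishes with [c]. Below the cut,
    [log1p (c * z) <= |c| |z|], and [normc_le_log1p] turns [|z|] back into [log1p z] at the cost of
    a factor [n.+1]; above it, [|c z| <= |z|]. *)
Lemma log1pZ_ctail n c z : normc c <= 1 ->
  log1p (c * z) <= normc c * n.+1%:R * log1p z + log1p (ctail n z).
Proof.
move=> c1; have z0 := log1p_ge0 z; have c0 := normc_ge0 c.
rewrite /ctail; case: ltP => zn.
  rewrite (@le_trans _ _ (log1p z))//.
    by apply: log1p_le; rewrite normcM ler_piMl ?normc_ge0.
  by rewrite lerDr !mulr_ge0.
rewrite log1p0 addr0 (le_trans (log1p_le_normc _))// normcM -mulrA.
apply: ler_wpM2l => //; apply: (le_trans (normc_le_log1p z)).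
by apply: ler_wpM2r => //; rewrite -natr1 addrC lerD2r.
Qed.

Lemma log1p_ctail_cvg0 z : log1p (ctail n z) @[n --> \oo] --> (0 : R).
Proof.
apply: cvg_near_cst; near=> n; rewrite /ctail ltNge ifF ?log1p0//.
apply/negbF; near: n; exists (Num.truncn (normc z)).+1 => // n /= nz.
by rewrite (le_trans (ltW (truncnS_gt _)))// ler_nat.
Unshelve. all: by end_near. Qed.

End Log1p.

(** * Integrated bounds and vanishing of the truncation tails *)

Section Lognorm.
Context {d : measure_display} {T : measurableType d} {R : realType}.
Context (mu : {measure set T -> \bar R}).
Implicit Types f g h : T -> R[i].

Lemma measurable_normc f : cmeasurable f ->
  measurable_fun [set: T] (fun x => normc (f x)).
Proof.
move=> [f1 f2].
rewrite (_ : (fun _ => _) = (@Num.sqrt R) \o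
   ((fun x => complex.Re (f x) ^+ 2) \+ (fun x => complex.Im (f x) ^+ 2))).
  apply: measurableT_comp.
    by apply: continuous_measurable_fun; exact: sqrt_continuous.
  by apply: measurable_funD; exact: measurable_funX.
by apply/funext => x /=; case: (f x).
Qed.

Lemma cmeasurable_if (b : T -> bool) f g : measurable_fun [set: T] b ->
  cmeasurable f -> cmeasurable g ->
  cmeasurable (fun x => if b x then f x else g x).
Proof.
move=> mb [f1 f2] [g1 g2]; split.
  rewrite (_ : (fun _ => _) =
    (fun x => if b x then complex.Re (f x) else complex.Re (g x))).
    exact: measurable_fun_ifT.
  by apply/funext => x; case: (b x).
rewrite (_ : (fun _ => _) =
  (fun x => if b x then complex.Im (f x) else complex.Im (g x))).
  exact: measurable_fun_ifT.
by apply/funext => x; case: (b x).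
Qed.

Lemma cmeasurable_ctail n f : cmeasurable f ->
  cmeasurable (fun x => ctail n (f x)).
Proof.
move=> mf.
apply: (@cmeasurable_if (fun x => n%:R < normc (f x)) f (fun=> 0)) => //.
by apply: measurable_fun_ltr; [exact: measurable_cst|exact: measurable_normc].
Qed.

(** Carries the pointwise truncation and scaling bounds over to integrals. *)
Lemma le_lognorm_lin (a : R) f g h : 0 <= a ->
  cmeasurable f -> cmeasurable g -> cmeasurable h ->
  (forall x, log1p (h x) <= a * log1p (f x) + log1p (g x)) ->
  (lognorm mu h <= a%:E * lognorm mu f + lognorm mu g)%E.
Proof.
move=> a0 mf mg mh hfg; have mf' := measurable_log1p mf.
have mg' := measurable_log1p mg.
have maf : measurable_fun [set: T] (fun x => a%:E * (log1p (f x))%:E)%E.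
  exact: measurable_funeM.
rewrite /lognorm -ge0_integralZl//=; last first.
  by move=> x _; rewrite lee_fin log1p_ge0.
rewrite -ge0_integralD//=.
- apply: ge0_le_integral => //=.
  + by move=> x _; rewrite lee_fin log1p_ge0.
  + exact: measurable_log1p.
  + exact: emeasurable_funD.
  + by move=> x _; rewrite -EFinM -EFinD lee_fin hfg.
- by move=> x _; rewrite lee_fin mulr_ge0// log1p_ge0.
- by move=> x _; rewrite lee_fin log1p_ge0.
Qed.

(** Dominated convergence: the tail is eventually 0 at each point, and [log1p (f x)] is an
    integrable majorant. *)
Lemma lognorm_ctail_cvg0 f : in_Llog mu f ->
  lognorm mu (fun x => ctail n (f x)) @[n --> \oo] --> 0%E.
Proof.
move=> [mf lf]; have mlf := measurable_log1p mf.
rewrite -(@integral0 _ _ _ mu setT).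
apply: (@dominated_cvg _ _ _ mu setT measurableT _ _
  (fun x => (log1p (f x))%:E)) => //.
- by move=> n; exact/measurable_log1p/cmeasurable_ctail.
- by move=> x _; apply: cvg_EFin; [near=> n|exact: log1p_ctail_cvg0].
- apply/integrableP; split=> //.
  rewrite (le_lt_trans _ lf)// le_eqVlt; apply/orP; left; apply/eqP.
  by apply: eq_integral => x _; rewrite gee0_abs// lee_fin log1p_ge0.
- move=> n x _; rewrite gee0_abs ?lee_fin ?log1p_ge0//; apply: log1p_le.
  by rewrite /ctail; case: ifP => // _; rewrite normc0 normc_ge0.
Unshelve. all: by end_near. Qed.

End Lognorm.

(** * Algebra laws and continuity of the operations *)

Section LlogNorm.
Context {d : measure_display} {T : measurableType d} {R : realType}.
Context (mu : {measure set T -> \bar R}).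
Implicit Types (F G : Llog mu) (c : R[i]).
Local Notation "F ** G" := (Llog_mul F G) (at level 40).

Lemma Llog_mulC F G : F ** G = G ** F.
Proof.
elim/(@Llog_ind d T R mu): F => f; elim/(@Llog_ind d T R mu): G => g.
by rewrite !Llog_mulE; apply: Llogfun_eq => x /=; rewrite mulrC.
Qed.

Lemma Llog_mulA : associative (@Llog_mul d T R mu).
Proof.
elim/(@Llog_ind d T R mu)=> f; elim/(@Llog_ind d T R mu)=> g.
elim/(@Llog_ind d T R mu)=> h.
by rewrite !Llog_mulE; apply: Llogfun_eq => x /=; rewrite mulrA.
Qed.

Lemma Llog_mulDl : left_distributive (@Llog_mul d T R mu) +%R.
Proof.
elim/(@Llog_ind d T R mu)=> f; elim/(@Llog_ind d T R mu)=> g.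
elim/(@Llog_ind d T R mu)=> h.
rewrite -[(_ + _)%R]/(Llog_add _ _) -[RHS]/(Llog_add _ _).
rewrite Llog_addE !Llog_mulE Llog_addE.
by apply: Llogfun_eq => x /=; rewrite mulrDl.
Qed.

Lemma Llog_mulDr : right_distributive (@Llog_mul d T R mu) +%R.
Proof. by move=> F G H; rewrite Llog_mulC Llog_mulDl !(Llog_mulC F). Qed.

Lemma Llog_scalerAl c F G : (c *: F) ** G = c *: (F ** G).
Proof.
elim/(@Llog_ind d T R mu): F => f; elim/(@Llog_ind d T R mu): G => g.
rewrite -[(c *: _)%R]/(Llog_scale _ _) -[RHS]/(Llog_scale _ _).
rewrite Llog_scaleE !Llog_mulE Llog_scaleE.
by apply: Llogfun_eq => x /=; rewrite mulrA.
Qed.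

Lemma Llog_scalerAr c F G : F ** (c *: G) = c *: (F ** G).
Proof. by rewrite Llog_mulC Llog_scalerAl Llog_mulC. Qed.

Lemma Llog_is_algebra_mul : is_algebra_mul (@Llog_mul d T R mu).
Proof.
split; [exact: Llog_mulA|exact: Llog_mulDl|exact: Llog_mulDr| |].
- exact: Llog_scalerAl.
- exact: Llog_scalerAr.
Qed.

Lemma Llog_norm_ge0 F : 0 <= Llog_norm F.
Proof. by rewrite fine_ge0// lognorm_ge0. Qed.

Lemma EFin_Llog_norm (f : Llogfun mu) :
  (Llog_norm (Llog_class f))%:E = lognorm mu f.
Proof. by rewrite Llog_normE fineK ?lognorm_fin. Qed.

Lemma cmeasurable_Llogfun (f : Llogfun mu) : cmeasurable f.
Proof. by have [] := LlogfunP f. Qed.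

Lemma Llog_normD F G : Llog_norm (F + G) <= Llog_norm F + Llog_norm G.
Proof.
elim/(@Llog_ind d T R mu): F => f; elim/(@Llog_ind d T R mu): G => g.
rewrite -[(Llog_class _ + _)%R]/(Llog_add _ _) Llog_addE -lee_fin EFinD.
rewrite !EFin_Llog_norm; apply: le_lognorm2; try exact: cmeasurable_Llogfun.
by move=> x; exact: log1pD.
Qed.

Lemma Llog_normM F G : Llog_norm (F ** G) <= Llog_norm F + Llog_norm G.
Proof.
elim/(@Llog_ind d T R mu): F => f; elim/(@Llog_ind d T R mu): G => g.
rewrite Llog_mulE -lee_fin EFinD.
rewrite !EFin_Llog_norm; apply: le_lognorm2; try exact: cmeasurable_Llogfun.
by move=> x; exact: log1pM.
Qed.

Lemma Llog_normZ c F :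
  Llog_norm (c *: F) <= (Num.truncn (normc c)).+1%:R * Llog_norm F.
Proof.
elim/(@Llog_ind d T R mu): F => f.
rewrite -[(_ *: _)%R]/(Llog_scale _ _) Llog_scaleE -lee_fin EFinM.
rewrite !EFin_Llog_norm -[leRHS]adde0.
(* The zero function fills the additive slot of [le_lognorm_lin]. *)
rewrite (_ : 0%E = lognorm mu (fun=> 0)); last first.
  by rewrite /lognorm normc0 addr0 ln1 integral0.
apply: le_lognorm_lin => //; try exact: cmeasurable_Llogfun.
by move=> x; rewrite log1p0 addr0; exact: log1pZ.
Qed.

(** Stands in for the homogeneity that [Llog_norm] lacks. The height [n] depends only on [F] and
    [e]: it makes the tail of [F] have norm at most [e], whatever [G] or [c] is. *)
Lemma Llog_norm_ctail F (e : R) : 0 < e -> exists n : nat,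
  (forall G, Llog_norm (F ** G) <= n.+1%:R * Llog_norm G + e) /\
  (forall c, normc c <= 1 ->
    Llog_norm (c *: F) <= normc c * n.+1%:R * Llog_norm F + e).
Proof.
move=> e0; elim/(@Llog_ind d T R mu): F => f; have mf := cmeasurable_Llogfun f.
have /fine_cvgP[fin_t cvg_t] := lognorm_ctail_cvg0 (LlogfunP f).
have /cvgrPdist_lt/(_ e e0) near_t := cvg_t.
have [n [tfin tn]] : exists n,
    lognorm mu (fun x => ctail n (f x)) \is a fin_num /\
    `|0 - fine (lognorm mu (fun x => ctail n (f x)))| < e.
  have [N _ h] : \forall n \near \oo,
    lognorm mu (fun x => ctail n (f x)) \is a fin_num /\
    `|0 - fine (lognorm mu (fun x => ctail n (f x)))| < e.
    by apply: filterS2 fin_t near_t => n ? ?.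
  by exists N; apply: h => /=.
have te : (lognorm mu (fun x => ctail n (f x)) <= e%:E)%E.
  rewrite -(fineK tfin) lee_fin ltW//.
  by move: tn; rewrite sub0r normrN; apply: le_lt_trans; exact: ler_norm.
have mt := cmeasurable_ctail n mf.
exists n; split=> [G|c c1].
  elim/(@Llog_ind d T R mu): G => g; rewrite Llog_mulE -lee_fin EFinD EFinM.
  rewrite !EFin_Llog_norm (le_trans _ (leeD2l _ te))//.
  apply: le_lognorm_lin => //; try exact: cmeasurable_Llogfun.
  by move=> x; exact: log1pM_ctail.
rewrite -[(_ *: _)%R]/(Llog_scale _ _) Llog_scaleE -lee_fin EFinD EFinM.
rewrite !EFin_Llog_norm (le_trans _ (leeD2l _ te))//.
apply: le_lognorm_lin => //; try exact: cmeasurable_Llogfun.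
  by rewrite mulr_ge0// normc_ge0.
by move=> x; exact: log1pZ_ctail.
Qed.

Lemma near_Llog_norm (F : Llog mu) (e : R) : 0 < e ->
  \forall G \near F, Llog_norm (G - F) < e.
Proof.
move=> e0; apply/(@metricType_numDomainType.nbhs_mdistP R (Llog mu)).
exists e => // G /=.
by rewrite metric_sym.
Qed.

(** Balls of [R[i]^o] have radii in [R[i]], so the real [e] is embedded there. *)
Lemma near_normc (c : R[i]^o) (e : R) : 0 < e ->
  \forall b \near c, normc (b - c : R[i]) < e.
Proof.
move=> e0; have e0' : 0 < e%:C%C :> R[i] by rewrite ltcR.
apply/nbhs_ballP; exists e%:C%C => // b; rewrite /ball/= => h.
by move: h; rewrite distrC normc_def ltcR; case: (b - c).
Qed.

Lemma Llog_add_continuous : continuous (fun z : Llog mu * Llog mu => z.1 + z.2).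
Proof.
move=> [F G]; apply/(@metricType_numDomainType.cvgrPdist_lt R (Llog mu)).
move=> e e0.
have e20 : 0 < e / 2 by lra.
exists ([set F' | Llog_norm (F' - F) < e / 2],
        [set G' | Llog_norm (G' - G) < e / 2]).
  by split; exact: near_Llog_norm.
move=> [F' G'] /= [HF HG]; rewrite metric_sym.
change (Llog_norm ((F' + G') - (F + G)) < e).
rewrite opprD addrACA (le_lt_trans (Llog_normD _ _))//; lra.
Qed.

Lemma Llog_mul_continuous :
  continuous (fun z : Llog mu * Llog mu => z.1 ** z.2).
Proof.
move=> [F G]; apply/(@metricType_numDomainType.cvgrPdist_lt R (Llog mu)).
move=> e e0.
have e40 : 0 < e / 4 by lra.
have [n [nF _]] := Llog_norm_ctail F e40.
have [m [mG _]] := Llog_norm_ctail G e40.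
(* Since [(n + m).+2 = n.+1 + m.+1], the two main terms add up to at most [e / 4]. The two tails
   cost [e / 4] each, and the product of the increments costs less than [2 r <= e / 4]. *)
pose r := e / (4 * (n + m).+2%:R).
have r0 : 0 < r by rewrite divr_gt0// mulr_gt0.
exists ([set F' | Llog_norm (F' - F) < r], [set G' | Llog_norm (G' - G) < r]).
  by split; exact: near_Llog_norm.
move=> [F' G'] /= [HF HG]; rewrite metric_sym.
change (Llog_norm ((F' ** G') - (F ** G)) < e).
have -> : F' ** G' - F ** G =
    F ** (G' - G) + (G ** (F' - F) + (F' - F) ** (G' - G)).
  rewrite -[F' in LHS](subrK F) -[G' in LHS](subrK G).
  move: (F' - F) (G' - G) => H K; rewrite Llog_mulDl !Llog_mulDr.
  by rewrite (Llog_mulC G H) addrA addrK [LHS]addrC [H ** K + _]addrC.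
have nm : (n + m).+2%:R * r = e / 4.
  have : 0 < (n + m).+2%:R :> R by rewrite ltr0n.
  by rewrite /r; move: (_.+2%:R) => q q0; field; rewrite gt_eqF.
move: nm; rewrite -addnS -addSn natrD mulrDl => nm.
have := nF (G' - G); have := mG (F' - F).
have := Llog_normM (F' - F) (G' - G).
have := Llog_normD (F ** (G' - G)) (G ** (F' - F) + (F' - F) ** (G' - G)).
have := Llog_normD (G ** (F' - F)) ((F' - F) ** (G' - G)).
have n1 : n.+1%:R * Llog_norm (G' - G) <= n.+1%:R * r.
  by rewrite ler_wpM2l// ltW.
have m1 : m.+1%:R * Llog_norm (F' - F) <= m.+1%:R * r.
  by rewrite ler_wpM2l// ltW.
have n2 : r <= n.+1%:R * r by rewrite ler_peMl ?ler1n// ltW.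
have m2 : r <= m.+1%:R * r by rewrite ler_peMl ?ler1n// ltW.
lra.
Qed.

Lemma Llog_scale_continuous :
  continuous (fun z : R[i]^o * Llog mu => z.1 *: z.2).
Proof.
move=> [c F]; apply/(@metricType_numDomainType.cvgrPdist_lt R (Llog mu)).
move=> e e0.
have e30 : 0 < e / 3 by lra.
have [n [_ nF]] := Llog_norm_ctail F e30.
(* Bounds the factor of [Llog_normZ] uniformly over all [c'] within distance 1 of [c]. *)
pose M := (Num.truncn (normc (c : R[i]) + 1)).+1%:R : R.
have M0 : 0 < M by rewrite ltr0n.
(* The [+ 1] keeps [K] positive when [F = 0] and makes the estimate [h2] strict. *)
pose K := 3 * n.+1%:R * (Llog_norm F + 1).
have F0 := Llog_norm_ge0 F.
have K0 : 0 < K by rewrite !mulr_gt0//; lra.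
(* The bound 1 serves both [M] and the condition [normc c <= 1] of the truncation estimate. *)
pose r := Num.min 1 (e / K).
have r0 : 0 < r by rewrite lt_min ltr01 divr_gt0.
have s0 : 0 < e / (3 * M) by rewrite divr_gt0// mulr_gt0.
exists ([set c' : R[i]^o | normc (c' - c : R[i]) < r],
        [set F' | Llog_norm (F' - F) < e / (3 * M)]).
  by split; [exact: near_normc|exact: near_Llog_norm].
move=> [c' F'] /= [Hc HF]; rewrite metric_sym.
change (Llog_norm (c' *: F' - c *: F) < e).
have -> : c' *: F' - c *: F = c' *: (F' - F) + (c' - c) *: F.
  by rewrite scalerBr scalerBl addrA subrK.
have [c1 c2] : normc (c' - c : R[i]) < 1 /\ normc (c' - c : R[i]) < e / K.
  by move: Hc; rewrite lt_min => /andP.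
have c'M : (Num.truncn (normc (c' : R[i]))).+1%:R <= M.
  rewrite ler_nat ltnS; apply: le_truncn.
  rewrite -[c' in leLHS](subrK c) (le_trans (ler_normcD _ _))//; lra.
have h1 : (Num.truncn (normc (c' : R[i]))).+1%:R * Llog_norm (F' - F) <= e / 3.
  have -> : e / 3 = M * (e / (3 * M)) by field; rewrite gt_eqF.
  by apply: ler_pM => //; [exact: Llog_norm_ge0|exact: ltW].
have h2 : normc (c' - c : R[i]) * n.+1%:R * Llog_norm F < e / 3.
  have -> : e / 3 = e / K * n.+1%:R * (Llog_norm F + 1).
    have : 0 < n.+1%:R :> R by rewrite ltr0n.
    rewrite /K; move: (_.+1%:R) (Llog_norm F) F0 => q p p0 q0.
    by field; rewrite !gt_eqF//; lra.
  rewrite (@le_lt_trans _ _ (e / K * n.+1%:R * Llog_norm F))//.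
    by rewrite ler_wpM2r// ler_wpM2r// ltW.
  by rewrite ltr_pM2l ?ltrDl// mulr_gt0// divr_gt0.
have := nF _ (ltW c1).
have := Llog_normD (c' *: (F' - F)) ((c' - c) *: F).
have := Llog_normZ c' (F' - F).
lra.
Qed.

End LlogNorm.

(** * Complex sequences with summable logarithmic increments *)

Section FastCauchy.
Context {R : realType}.
Implicit Types (z : nat -> R[i]) (l w : R[i]).

Lemma normr_Re_le w : `|complex.Re w| <= normc w.
Proof.
case: w => a b /=; rewrite -sqrtr_sqr ler_wsqrtr// lerDl; exact: sqr_ge0.
Qed.

Lemma normr_Im_le w : `|complex.Im w| <= normc w.
Proof.
case: w => a b /=; rewrite -sqrtr_sqr ler_wsqrtr// lerDr; exact: sqr_ge0.
Qed.

Lemma normc_le_ReIm w : normc w <= `|complex.Re w| + `|complex.Im w|.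
Proof.
case: w => a b /=; rewrite -[leRHS]ger0_norm ?addr_ge0//.
rewrite -[leRHS]sqrtr_sqr ler_wsqrtr// sqrrD !real_normK ?num_real//.
by rewrite -addrA lerD2l lerDr mulrn_wge0// mulr_ge0.
Qed.

Lemma log1p_telescope_le z n :
  log1p (z n - z 0%N) <= \sum_(0 <= j < n) log1p (z j.+1 - z j).
Proof.
elim: n => [|n IH]; first by rewrite subrr log1p0 big_geq.
rewrite big_nat_recr//= (le_trans _ (lerD IH (lexx _)))//.
have -> : z n.+1 - z 0%N = (z n - z 0%N) + (z n.+1 - z n).
  by rewrite [RHS]addrC addrA subrK.
exact: log1pD.
Qed.

(** Telescoping bounds [log1p (z (m + k) - z k)] by a partial sum of the series; the remaining
    [log1p (l - z (m + k))] is at most [e] once both coordinates are within [e / 2] of their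
    limits. *)
Lemma log1p_sub_lim_le z l (k : nat) :
  complex.Re (z n) @[n --> \oo] --> complex.Re l ->
  complex.Im (z n) @[n --> \oo] --> complex.Im l ->
  ((log1p (l - z k))%:E <=
   \sum_(j <oo) (log1p (z (j + k).+1 - z (j + k)%N))%:E)%E.
Proof.
move=> zRe zIm; apply/lee_addgt0Pr => e e0.
have e20 : 0 < e / 2 by lra.
have /cvgrPdist_lt/(_ _ e20) [N _ NRe] := zRe.
have /cvgrPdist_lt/(_ _ e20) [M _ MIm] := zIm.
pose m := maxn N M.
have mRe : `|complex.Re l - complex.Re (z (m + k)%N)| < e / 2.
  by apply: NRe; rewrite /= (leq_trans (leq_maxl N M))// leq_addr.
have mIm : `|complex.Im l - complex.Im (z (m + k)%N)| < e / 2.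
  by apply: MIm; rewrite /= (leq_trans (leq_maxr N M))// leq_addr.
have lm : log1p (l - z (m + k)%N) <= e.
  rewrite (le_trans (log1p_le_normc _))// (le_trans (normc_le_ReIm _))//.
  have -> : complex.Re (l - z (m + k)%N) =
      complex.Re l - complex.Re (z (m + k)%N).
    by case: (l) (z (m + k)%N) => ? ? [].
  have -> : complex.Im (l - z (m + k)%N) =
      complex.Im l - complex.Im (z (m + k)%N).
    by case: (l) (z (m + k)%N) => ? ? [].
  lra.
apply: (@le_trans _ _
  (\sum_(0 <= j < m) (log1p (z (j + k).+1 - z (j + k)%N))%:E + e%:E)%E);
  last first.
  apply: leeD2r; apply: nneseries_lim_ge => n _ _.
  by rewrite lee_fin log1p_ge0.
rewrite sumEFin -EFinD lee_fin.
have := log1p_telescope_le (fun j => z (j + k)%N) m; rewrite /= add0n => h.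
have -> : l - z k = (z (m + k)%N - z k) + (l - z (m + k)%N).
  by rewrite [RHS]addrC addrA subrK.
by rewrite (le_trans (log1pD _ _))// lerD.
Qed.

(** The abstract [p] covers real and imaginary parts at once. If [s] is the sum of the series, each
    [1 + |z j.+1 - z j|] is at most [expR s], so the increments of [p (z n)] are dominated by
    [expR s] times a summable sequence. *)
Lemma is_cvg_summable_log1p z (p : R[i] -> R) :
  (forall a b, p (a - b) = p a - p b) -> (forall w, `|p w| <= normc w) ->
  (\sum_(j <oo) (log1p (z j.+1 - z j))%:E < +oo)%E ->
  cvgn (fun n => p (z n)).
Proof.
move=> pB p_le zoo; set D := fun j => log1p (z j.+1 - z j).
have D0 j : (0 <= (D j)%:E)%E by rewrite lee_fin log1p_ge0.
have [s Ss] : exists s : R, (\sum_(j <oo) (D j)%:E)%E = s%:E.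
  exists (fine (\sum_(j <oo) (D j)%:E)%E); rewrite fineK// ge0_fin_numE//.
  exact: nneseries_ge0.
have Ds n : series D n <= s.
  rewrite seriesEnat/= -lee_fin -Ss -sumEFin.
  by apply: nneseries_lim_ge => *; exact: D0.
have Dj j : D j <= s.
  apply: le_trans (Ds j.+1); rewrite seriesEnat/= big_nat_recr//= lerDr.
  by apply: sumr_ge0 => i _; exact: log1p_ge0.
have cD : cvgn (series D).
  apply: nondecreasing_is_cvgn; last by exists s => _ [n _ <-].
  apply/nondecreasing_seqP => n.
  rewrite seriesEnat/= big_nat_recr//= lerDl; exact: log1p_ge0.
pose u n := p (z n).
have ct : cvgn (series (telescope u)).
  apply: normed_cvg.
  apply: (@series_le_cvg R _ (expR s *: D)) => //.
  - by move=> n; exact: normr_ge0.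
  - by move=> n; rewrite mulr_ge0 ?expR_ge0 ?log1p_ge0.
  - move=> n; rewrite /telescope/= /u -pB (le_trans (p_le _))//.
    rewrite (le_trans (normc_le_log1p _))//; apply: ler_wpM2r.
      exact: log1p_ge0.
    have pos : 0 < 1 + normc (z n.+1 - z n) by rewrite ltr_wpDr ?normc_ge0.
    rewrite -[leLHS]lnK ?posrE// ler_expR; exact: Dj.
  - exact: is_cvg_seriesZ.
have -> : (fun n => p (z n)) = (fun n => u 0%N + series (telescope u) n).
  by apply/funext => n; rewrite -eq_sum_telescope.
by apply: is_cvgD => //; exact: is_cvg_cst.
Qed.

End FastCauchy.

(** * Completeness of the metric *)

Section Complete.
Context {d : measure_display} {T : measurableType d} {R : realType}.
Context (mu : {measure set T -> \bar R}).

(** Stated for representatives, since the limit is built pointwise. *)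
Lemma Llog_summable_limit (v : nat -> Llogfun mu) :
  (\sum_(j <oo) lognorm mu (fun x => v j.+1 x - v j x)%R < +oo)%E ->
  exists l : Llogfun mu, forall k,
    (lognorm mu (fun x => l x - v k x)%R <=
     \sum_(k <= j <oo) lognorm mu (fun x => v j.+1 x - v j x)%R)%E.
Proof.
move=> voo.
pose D j x := (log1p (v j.+1 x - v j x))%:E.
have mB (f g : T -> R[i]) : cmeasurable f -> cmeasurable g ->
    cmeasurable (fun x => f x - g x).
  move=> mf mg; rewrite (_ : (fun _ => _) = (fun x => f x + (-1) * g x)).
    by apply: cmeasurableD => //; apply: cmeasurableM => //;
      exact: cmeasurable_cst.
  by apply/funext => x; rewrite mulN1r.
have mv k : cmeasurable (v k) by exact: cmeasurable_Llogfun.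
have mD j : measurable_fun [set: T] (D j) by exact/measurable_log1p/mB.
have D0 j x : (0 <= D j x)%E by rewrite lee_fin log1p_ge0.
pose S k x := (\sum_(j <oo) D (j + k)%N x)%E.
have mS k : measurable_fun [set: T] (S k).
  exact: (@ge0_emeasurable_sum _ _ _ _ (fun j => D (j + k)%N) xpredT).
have intS k : (\int[mu]_x S k x =
    \sum_(k <= j <oo) lognorm mu (fun x => v j.+1 x - v j x)%R)%E.
  rewrite /S integral_nneseries//.
  rewrite -[RHS]nneseries_addn// => i; exact: lognorm_ge0.
(* Cutting [v k] off where the series diverges makes it converge everywhere. *)
pose b x := (S 0%N x < +oo)%E.
have mb : measurable_fun [set: T] b.
  by apply: measurable_fun_lte => //; exact: measurable_cst.
pose g k x := if b x then v k x else 0.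
have mg k : cmeasurable (g k).
  by apply: cmeasurable_if => //; exact: cmeasurable_cst.
(* This holds at every point: outside [b] all the increments are 0. *)
have goo x : (\sum_(j <oo) (log1p (g j.+1 x - g j x))%:E < +oo)%E.
  rewrite /g; case: (boolP (b x)) => [bx|_].
    apply: le_lt_trans bx; rewrite le_eqVlt; apply/orP; left; apply/eqP.
    by apply: eq_eseriesr => j _; rewrite addn0.
  by rewrite eseries0// => j _ _; rewrite subrr log1p0.
pose l x : R[i] := (limn (fun n => complex.Re (g n x)) +i*
                    limn (fun n => complex.Im (g n x)))%C.
have cRe x : complex.Re (g n x) @[n --> \oo] --> complex.Re (l x).
  apply: (@is_cvg_summable_log1p _ (g^~ x)) => //; last exact: normr_Re_le.
  by move=> [? ?] [? ?].
have cIm x : complex.Im (g n x) @[n --> \oo] --> complex.Im (l x).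
  apply: (@is_cvg_summable_log1p _ (g^~ x)) => //; last exact: normr_Im_le.
  by move=> [? ?] [? ?].
have ml : cmeasurable l.
  split.
    by apply: (measurable_fun_cvg (h := fun n x => complex.Re (g n x))) => // m;
      have [] := mg m.
  by apply: (measurable_fun_cvg (h := fun n x => complex.Im (g n x))) => // m;
    have [] := mg m.
(* By [intS], [S 0] has a finite integral, hence is finite almost everywhere. *)
have aeb : {ae mu, forall x, b x}.
  have /integrable_ae : mu.-integrable setT (S 0%N).
    apply/integrableP; split=> //.
    under eq_integral do rewrite gee0_abs ?nneseries_ge0//.
    by rewrite intS.
  move=> /(_ measurableT); apply: filterS => x /(_ I).
  by rewrite ge0_fin_numE// nneseries_ge0.
have lv k : (lognorm mu (fun x => l x - v k x)%R <=
     \sum_(k <= j <oo) lognorm mu (fun x => v j.+1 x - v j x)%R)%E.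
  rewrite -intS; apply: ae_ge0_le_integral => //.
  - by move=> x _; rewrite lee_fin log1p_ge0.
  - exact/measurable_log1p/mB.
  - by move=> x _; exact: nneseries_ge0.
  - apply: filterS aeb => x bx _.
    have gv n : g n x = v n x by rewrite /g bx.
    have := @log1p_sub_lim_le _ (g^~ x) (l x) k (cRe x) (cIm x).
    by under eq_eseriesr do rewrite !gv; rewrite gv.
(* Write [l = (l - v 0) + v 0]; the first term is controlled by the whole series. *)
have lin : in_Llog mu l.
  split=> //.
  apply: (@le_lt_trans _ _ (lognorm mu (fun x => l x - v 0%N x)%R +
                            lognorm mu (v 0%N))%E).
    apply: le_lognorm2 => //; first exact: mB.
    by move=> x; rewrite -{1}(subrK (v 0%N x) (l x)); exact: log1pD.
  apply: lte_add_pinfty; first exact: le_lt_trans (lv 0%N) voo.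
  by have [] := LlogfunP (v 0%N).
by exists (mkLlogfun lin).
Qed.

Lemma Llog_is_complete_metric : is_complete_metric (Llog mu).
Proof.
move=> u uC.
have /choice[N NP] : forall k : nat, exists N : nat, forall m n : nat,
    (N <= m)%N -> (N <= n)%N -> mdist (u m) (u n) < 1 / (2 ^ k.+1)%:R.
  by move=> k; apply: uC; rewrite divr_gt0// ltr0n expn_gt0.
(* The maximum puts both [s k] and [s k.+1] past [N k], so consecutive terms are within
   [1 / 2 ^ k.+1]; the summand [k] makes [s] unbounded. *)
pose s k := (k + \max_(i < k.+1) N i)%N.
have Ns i k : (i <= k)%N -> (N i <= s k)%N.
  move=> ik; rewrite (@leq_trans (\max_(i < k.+1) N i)) ?leq_addl//.
  by rewrite (leq_bigmax (Ordinal (ik : (i < k.+1)%N))).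
pose v k : Llogfun mu := repr (u (s k)).
have vE k : Llog_class (v k) = u (s k) by rewrite reprLlogK.
have distE F G (f g : Llogfun mu) : Llog_class f = F -> Llog_class g = G ->
    (mdist F G)%:E = lognorm mu (fun x => f x - g x)%R.
  by move=> <- <-; rewrite mdist_LlogE Llog_distE.
have voo : (\sum_(j <oo) lognorm mu (fun x => v j.+1 x - v j x)%R < +oo)%E.
  apply: (@le_lt_trans _ _ 1%:E); last exact: ltry.
  apply: le_trans (@epsilon_trick0 R 1 xpredT ler01).
  apply: lee_nneseries => [i _ _|k _]; first exact: lognorm_ge0.
  rewrite -(distE _ _ _ _ (vE _) (vE _)) lee_fin ltW//.
  by apply: NP; exact: Ns.
have [l lP] := Llog_summable_limit voo.
exists (Llog_class l).
apply/(@metricType_numDomainType.cvgrPdist_lt R (Llog mu)).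
move=> e e0; have e20 : 0 < e / 2 by lra.
have [N0 N0P] := uC _ e20.
have /fine_cvgP[tfin tcvg] :=
  nneseries_tail_cvg voo (fun k _ => lognorm_ge0 mu _).
have /cvgrPdist_lt/(_ _ e20) tlt := tcvg.
have [K _ KP] := filterI tfin tlt.
(* [K] makes the tail of the series smaller than [e / 2], and [N0] gives [N0 <= s k], so that the
   Cauchy condition compares [u (s k)] with [u n]. *)
pose k := maxn K N0.
have [kfin klt] := KP k (leq_maxl _ _).
have lk : mdist (Llog_class l) (u (s k)) < e / 2.
  rewrite -lte_fin (distE _ _ _ _ erefl (vE k)) (le_lt_trans (lP k))//.
  rewrite -(fineK kfin) lte_fin; move: klt; rewrite sub0r normrN.
  by apply: le_lt_trans; exact: ler_norm.
exists N0 => // n /= N0n.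
have := metric_triangle (Llog_class l) (u (s k)) (u n).
have := N0P (s k) n (leq_trans (leq_maxr K N0) (leq_addr _ _)) N0n.
lra.
Qed.

End Complete.

Theorem corollary2p7 (d : measure_display) (T : measurableType d)
    (R : realType) (mu : {measure set T -> \bar R}) :
  @is_topological_algebra R[i] (Llog mu) (@Llog_mul d T R mu) /\
  @is_complete_metric R (Llog mu).
Proof.
split; last exact: Llog_is_complete_metric.
split; first exact: Llog_is_algebra_mul.
- exact: Llog_add_continuous.
- exact: Llog_scale_continuous.
- exact: Llog_mul_continuous.
Qed.
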